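(* There is a streaming algorithm that, given $\varepsilon\in(0,\tfrac12)$ and $\alpha,\delta\in(0,1)$, obtains with probability at least $1-\delta$ a $(1\pm\varepsilon)$-approximation to $F_1$ of the final frequency vector in the $\alpha$-RFDS model, using $O\!\left(\frac{1}{1-\alpha}\cdot\frac{1}{\varepsilon^2}\log n\log\frac{1}{\delta}\right)$ bits of space.
   Context: Forget model: the universe is $[n]$; the stream (of length $m=\mathrm{poly}(n)$) consists of insertions $(i,+)$, which increment coordinate $i$, and forget requests on an index $i$, which set coordinate $i$ of the current frequency vector to $0$. $\mathbf{g}$ is the final vector after all operations; $\mathbf{f}$ is the final vector if all forget requests are removed. $F_1(\mathbf{v})=\sum_i|v_i|$. The $\alpha$-RFDS model is the promise $F_1(\mathbf{g})\ge(1-\alpha)F_1(\mathbf{f})$. *)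

(* Defs.v *)
From HB Require Import structures.
From mathcomp Require Import all_boot all_order all_algebra.
From mathcomp Require Import reals exp.
Set Implicit Arguments. Unset Strict Implicit. Unset Printing Implicit Defensive.
Import Order.TTheory GRing.Theory Num.Theory.
Local Open Scope ring_scope.

Inductive op (n : nat) : Type :=
| Ins of 'I_n
| Forget of 'I_n.

Definition step_g (n : nat) (v : 'I_n -> nat) (o : op n) : 'I_n -> nat :=
  match o with
  | Ins i => fun j => if j == i then (v j).+1 else v j
  | Forget i => fun j => if j == i then 0%N else v j
  end.

Definition gvec (n : nat) (s : seq (op n)) : 'I_n -> nat :=
  foldl (@step_g n) (fun _ => 0%N) s.

Definition is_ins (n : nat) (o : op n) : bool :=
  if o is Ins _ then true else false.

Definition fvec (n : nat) (s : seq (op n)) : 'I_n -> nat :=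
  gvec [seq o <- s | is_ins o].

(** F_1(v) = sum_i |v_i| (entries are natural numbers, hence |v_i| = v_i). *)
Definition F1 (n : nat) (v : 'I_n -> nat) : nat := (\sum_(i < n) v i)%N.

Definition RFDS {R : realType} (alpha : R) (n : nat) (s : seq (op n)) : Prop :=
  (1 - alpha) * (F1 (fvec s))%:R <= (F1 (gvec s))%:R.

(** * Randomized streaming algorithms with S bits of memory

  The whole memory carried between stream updates is a state of [S] bits.
  At each step (initialisation, each update, and the final query) the
  algorithm may draw [rbits] fresh uniformly random bits; random bits that
  the algorithm wants to reuse must be stored in the state. *)
Record algo (R : realType) (n S : nat) : Type := Algo {
  rbits : nat;
  a_init : rbits.-tuple bool -> S.-tuple bool;
  a_upd : S.-tuple bool -> op n -> rbits.-tuple bool -> S.-tuple bool;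
  a_out : S.-tuple bool -> rbits.-tuple bool -> R
}.

(** Run the algorithm on the stream [s] with random tape [rs]
    (entry 0: initialisation, entry k+1: k-th update, last entry: query). *)
Definition run (R : realType) (n S : nat) (A : algo R n S) (s : seq (op n))
    (rs : (size s).+2.-tuple ((rbits A).-tuple bool)) : R :=
  let d := [tuple of nseq (rbits A) false] in
  let st0 := a_init (nth d rs 0) in
  let st := foldl (fun st (p : op n * nat) => a_upd st p.1 (nth d rs p.2.+1))
                  st0 (zip s (iota 0 (size s))) in
  a_out st (nth d rs (size s).+1).

Definition succ_prob (R : realType) (n S : nat) (A : algo R n S) (eps : R)
    (s : seq (op n)) : R :=
  (#|[set rs : (size s).+2.-tuple ((rbits A).-tuple bool) |
       `|run rs - (F1 (gvec s))%:R| <= eps * (F1 (gvec s))%:R]|)%:R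
  / (#|{: (size s).+2.-tuple ((rbits A).-tuple bool)}|)%:R.

(* Main.v *)
(** Number the insertions 0, 1, 2, ... and call one live if its element has not
    been forgotten since; the number of live insertions is F_1(g). Each of K
    samplers stores a uniform word U of L bits, drawn once, and tracks the
    insertion number U mod B(t), where t is the number of insertions so far and
    B(t) is a power of two with t < B(t) <= 2t. When B doubles, the residue
    either stays or moves past all insertions seen so far, so a sampler never
    needs information that it has dropped, although no fresh coin is tossed.
    Since B(t) divides 2^L, a sampler holds a live insertion with probability
    exactly F_1(g) / B(t), which is at least (1 - alpha) / 2 under the promise,
    and a Chernoff bound gives the number of samplers. *)

Require Import Defs.
From HB Require Import structures.
From mathcomp Require Import all_boot all_order all_algebra.
From mathcomp Require Import reals sequences exp.
From mathcomp Require Import ring lra zify.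
Set Implicit Arguments. Unset Strict Implicit. Unset Printing Implicit Defensive.
Import Order.TTheory GRing.Theory Num.Theory.
Local Open Scope ring_scope.

(** * Live insertions, and windows whose length is a power of two *)

Section Stream.
Local Open Scope nat_scope.
Variable n : nat.
Implicit Types (s : seq (op n)) (o : op n) (i : 'I_n) (p b : nat).

Definition n_ins s := count (@is_ins n) s.

Definition live_step (st : nat * (nat -> option 'I_n)) o :=
  match o with
  | Ins i => (st.1.+1, fun p => if p == st.1 then Some i else st.2 p)
  | Forget i => (st.1, fun p => if st.2 p == Some i then None else st.2 p)
  end.

(* The element inserted by the [p]-th insertion of [s] (counting from 0), or
   [None] if that insertion does not exist or has since been forgotten. *)
Definition live s : nat -> option 'I_n :=
  (foldl live_step (0, fun _ => None) s).2.

Lemma live_step_count s :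
  (foldl live_step (0, fun _ => None) s).1 = n_ins s.
Proof.
elim/last_ind: s => // s o IH.
by rewrite foldl_rcons /n_ins -cats1 count_cat /= -/(n_ins s) -IH; case: o => i /=;
  rewrite ?addn0 ?addn1.
Qed.

Lemma n_ins_rcons s o : n_ins (rcons s o) = n_ins s + is_ins o.
Proof. by rewrite /n_ins -cats1 count_cat /= addn0. Qed.

Lemma live_Ins s i p :
  live (rcons s (Ins i)) p = if p == n_ins s then Some i else live s p.
Proof. by rewrite /live foldl_rcons /= live_step_count. Qed.

Lemma live_Forget s i p :
  live (rcons s (Forget i)) p = if live s p == Some i then None else live s p.
Proof. by rewrite /live foldl_rcons. Qed.

Lemma live_late s p : n_ins s <= p -> live s p = None.
Proof.
elim/last_ind: s => // s [] i IH; rewrite n_ins_rcons /= ?addn1 ?addn0 => le_p.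
  by rewrite live_Ins gtn_eqF // IH // ltnW.
by rewrite live_Forget IH.
Qed.

Lemma gvec_rcons s o : gvec (rcons s o) = step_g (gvec s) o.
Proof. by rewrite /gvec foldl_rcons. Qed.

(** An insertion fills a place that was empty, and a forget request empties exactly the places
    holding its index. The bound [b] is left free so that it can be a window length. *)
Lemma gvec_live s b i :
  n_ins s <= b -> \sum_(p < b) (live s p == Some i) = gvec s i.
Proof.
elim/last_ind: s => [_|s o IH]; first by rewrite big1.
rewrite n_ins_rcons gvec_rcons; case: o => j /=; rewrite ?addn1 ?addn0 => le_b.
  rewrite -[in RHS]IH 1?ltnW //.
  rewrite (bigD1 (Ordinal le_b)) //= live_Ins eqxx.
  rewrite [in RHS](bigD1 (Ordinal le_b)) //= live_late // add0n.
  have -> : \sum_(k < b | k != Ordinal le_b) (live (rcons s (Ins j)) k == Some i)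
          = \sum_(k < b | k != Ordinal le_b) (live s k == Some i).
    by apply: eq_bigr => k; rewrite -val_eqE /= live_Ins => /negPf ->.
  by rewrite [_ == _]eq_sym -[Some i == _]/(i == j); case: (i == j); rewrite ?add1n.
case: (altP (i =P j)) => [<-|ne_ij].
  by rewrite big1 // => p _; rewrite live_Forget; case: ifP => // ->.
rewrite -IH //; apply: eq_bigr => p _; rewrite live_Forget.
by case: ifP => // /eqP ->; rewrite -[Some j == _]/(j == i) [j == i]eq_sym (negPf ne_ij).
Qed.

Lemma F1_gvec_live s b :
  n_ins s <= b -> \sum_(p < b) (live s p : bool) = F1 (gvec s).
Proof.
move=> le_b; rewrite /F1.
under [RHS]eq_bigr do rewrite -(gvec_live _ le_b).
rewrite exchange_big; apply: eq_bigr => p _ /=.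
case: (live s p) => [i|] /=; last by rewrite big1.
rewrite (bigD1 i) //= eqxx big1 // => j ne_ji.
by rewrite -[Some i == _]/(i == j) eq_sym (negPf ne_ji).
Qed.

(** Lets the promise compare $F_1(g)$ with the insertion counter. *)
Lemma F1_fvec s : F1 (fvec s) = n_ins s.
Proof.
rewrite /fvec; elim/last_ind: s => [|s o IH]; first by rewrite /F1 big1.
rewrite filter_rcons n_ins_rcons; case: o => i /=; rewrite ?addn0 //.
rewrite gvec_rcons -IH /F1 /= (bigD1 i) //= eqxx [in RHS](bigD1 i) //= addn1 addSn.
by congr (_ + _).+1; apply: eq_bigr => j /negPf ->.
Qed.

(** The least power of two above [t], except that [window 0] is 2. *)
Definition window t := 2 ^ (trunc_log 2 t).+1.

Lemma window_gt t : t < window t.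
Proof. exact: trunc_log_ltn. Qed.

Lemma window_le t : 0 < t -> window t <= 2 * t.
Proof. by move=> t_gt0; rewrite /window expnS leq_mul2l trunc_logP. Qed.

Lemma window_gt0 t : 0 < window t.
Proof. by rewrite expn_gt0. Qed.

Lemma window_dvd t L : t < 2 ^ L -> 0 < L -> window t %| 2 ^ L.
Proof.
move=> ltL L_gt0; apply: dvdn_exp2l.
case: (posnP t) => [->|t_gt0]; first by rewrite trunc_log0.
by rewrite -(ltn_exp2l _ _ (isT : 1 < 2)) (leq_ltn_trans _ ltL) // trunc_logP.
Qed.

(* Doubling the window either keeps the residue or moves it past every
   insertion seen so far. *)
Lemma modn_windowS t w :
  w %% window t.+1 = w %% window t \/ t < w %% window t.+1.
Proof.
case: (leqP (w %% window t.+1) t) => [le|]; [left|by right].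
rewrite -[RHS](@modn_dvdm (window t.+1)); last first.
  by rewrite dvdn_exp2l // ltnS leq_trunc_log.
by rewrite [RHS]modn_small // (leq_ltn_trans le) ?window_gt.
Qed.

(** Each residue modulo [b] occurs [N / b] times below [N]: a uniform word stays uniform when
    reduced. *)
Lemma sum_modn (N b : nat) (Q : nat -> nat) :
  0 < b -> b %| N ->
  (\sum_(p < N) Q (p %% b)) * b = N * \sum_(p < b) Q p.
Proof.
move=> b_gt0 /dvdnP[k ->].
rewrite -(big_mkord xpredT (fun p => Q (p %% b))) big_nat_mul.
rewrite (eq_bigr (fun=> \sum_(p < b) Q p)); last first.
  move=> j _; rewrite mulSn -{1}[j * b]add0n big_addn addnK big_mkord.
  by apply: eq_bigr => p _; rewrite addnC modnMDl modn_small.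
by rewrite sum_nat_const_nat subn0 mulnAC.
Qed.

End Stream.

(** * A Chernoff bound for independent uniform samples, by counting *)

Section Chernoff.
Variable R : realType.

(** Since exp(-y) >= 1 - y, exp(y) is at most 1 / (1 - y). Negative [y] are allowed, so the bound
    serves both tails. *)
Lemma expR_le_quadratic (y : R) : y <= 1 / 2 -> expR y <= 1 + y + 2 * y ^+ 2.
Proof.
move=> le_y.
have y1 : 0 < 1 - y by lra.
have ey : expR y * (1 - y) <= 1.
  by rewrite -[leRHS](expRxMexpNx_1 y) ler_pM2l ?expR_gt0 //; exact: (expR_ge1Dx (- y)).
rewrite -(ler_pM2r y1); apply: (le_trans ey).
rewrite -subr_ge0.
have -> : (1 + y + 2 * y ^+ 2) * (1 - y) - 1 = y ^+ 2 * (1 - 2 * y) by ring.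
by rewrite mulr_ge0 ?sqr_ge0 //; lra.
Qed.

Variables (W : finType) (G : pred W) (K : nat).
Hypothesis W_gt0 : (0 < #|W|)%N.

Definition hits (u : {ffun 'I_K -> W}) : nat := \sum_k G (u k).

Local Notation p := (#|G|%:R / #|W|%:R : R).

(** Independence enters here: a product of sums over [W] expands into a sum over all functions
    [u]. *)
Lemma moment_generating (y : R) :
  \sum_u expR (y * (hits u)%:R) =
  #|{ffun 'I_K -> W}|%:R * (1 + p * (expR y - 1)) ^+ K.
Proof.
have W0 : (#|W|%:R : R) != 0 by rewrite pnatr_eq0 -lt0n.
rewrite card_ffun card_ord natrX -exprMn.
transitivity (\prod_(k < K) \sum_(a : W) expR (y * (G a)%:R)).
  rewrite bigA_distr_bigA; apply: eq_bigr => u _.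
  by rewrite /hits natr_sum mulr_sumr expR_sum.
rewrite prodr_const card_ord; congr (_ ^+ _).
rewrite (eq_bigr (fun a => 1 + (expR y - 1) * (G a)%:R)); last first.
  by move=> a _; case: (G a); rewrite ?mulr1 ?mulr0 ?expR0; ring.
rewrite big_split /= sumr_const -mulr_sumr -natr_sum.
have -> : (\sum_(a : W) G a = #|G|)%N.
  rewrite -sum1_card [RHS]big_mkcond; apply: eq_bigr => a _.
  by rewrite unfold_in; case: (G a).
by rewrite -[LHS]/(#|W|%:R + _) mulrDr mulr1; congr (_ + _); field.
Qed.

(** Markov's inequality for exp(y * hits); positive [y] gives the upper tail, negative [y] the
    lower. *)
Lemma exp_markov (y b : R) : y <= 1 / 2 ->
  #|[set u : {ffun 'I_K -> W} | b <= y * (hits u)%:R]|%:R <=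
  #|{ffun 'I_K -> W}|%:R * expR (K%:R * p * (y + 2 * y ^+ 2) - b).
Proof.
move=> le_y.
set A := [set u | _].
have ineqA : #|A|%:R * expR b <= \sum_u expR (y * (hits u)%:R).
  rewrite -sum1_card natr_sum mulr_suml.
  rewrite [leRHS](bigID (mem A)) /= ler_wpDr ?sumr_ge0 // => [u _|].
    exact: expR_ge0.
  by apply: ler_sum => u; rewrite inE mul1r ler_expR.
rewrite expRB mulrA ler_pdivlMr ?expR_gt0 // (le_trans ineqA) //.
rewrite moment_generating ler_wpM2l // -mulrA expRM_natl.
have p0 : 0 <= p by rewrite divr_ge0.
have p1 : p <= 1 by rewrite ler_pdivrMr ?ltr0n // mul1r ler_nat max_card.
have ey : 1 + p * (expR y - 1) <= 1 + p * (y + 2 * y ^+ 2).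
  by rewrite lerD2l ler_wpM2l //; have := expR_le_quadratic le_y; lra.
apply: lerXn2r; rewrite ?nnegrE ?expR_ge0 //.
  have := expR_gt0 y; nra.
exact: le_trans ey (expR_ge1Dx _).
Qed.

Lemma chernoff (eps : R) : 0 < eps -> eps <= 1 ->
  #|[set u : {ffun 'I_K -> W} |
      eps * (K%:R * p) < `|(hits u)%:R - K%:R * p|]|%:R <=
  #|{ffun 'I_K -> W}|%:R * (2 * expR (- (K%:R * p * eps ^+ 2 / 8))).
Proof.
move=> eps0 eps1.
(* The choice y = eps / 4 minimises 2 y^2 - eps y, with value - eps^2 / 8; the lower tail is
   symmetric. *)
have := @exp_markov (eps / 4) (eps / 4 * ((1 + eps) * (K%:R * p))).
have := @exp_markov (- (eps / 4)) (- (eps / 4) * ((1 - eps) * (K%:R * p))).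
set A := [set u | _]; set B := [set u | _]; set D := [set u | _] => hA hB.
have DAB : D \subset A :|: B.
  apply/subsetP => u; rewrite !inE; move: (K%:R * p) => m.
  have e4 : 0 < eps / 4 by lra.
  rewrite !mulNr lerN2 !(ler_pM2l e4); case: (lerP m (hits u)%:R) => le_m.
    by move=> h; apply/orP; right; lra.
  by move=> h; apply/orP; left; lra.
have leD : (#|D|%:R : R) <= #|A|%:R + #|B|%:R.
  rewrite -natrD ler_nat (leq_trans (subset_leq_card DAB)) //.
  by rewrite cardsU leq_subr.
apply: (le_trans leD).
have -> : forall x z : R, x * (2 * z) = x * z + x * z by move=> *; ring.
apply: lerD.
  apply: (le_trans (hA _)); first by lra.
  by rewrite ler_wpM2l // ler_expR le_eqVlt; apply/orP; left;
    apply/eqP; move: (K%:R * p) => m; field.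
apply: (le_trans (hB _)); first by lra.
by rewrite ler_wpM2l // ler_expR le_eqVlt; apply/orP; left;
    apply/eqP; move: (K%:R * p) => m; field.
Qed.

End Chernoff.

(** * From finite state machines to algorithms on bit strings *)

Section FiniteMemory.
Local Open Scope nat_scope.

Lemma card_embed (T U : finType) : #|T| <= #|U| -> 0 < #|T| ->
  exists (f : T -> U) (g : U -> T), cancel f g.
Proof.
move=> leTU /card_gt0P[t0 _].
exists (fun x => enum_val (widen_ord leTU (enum_rank x))).
(* [t0] is a junk value for codes outside the image of [f]. *)
exists (fun y => odflt t0 (omap (@enum_val T T) (insub (val (enum_rank y))))).
move=> x; rewrite enum_valK /= insubT //= => lt_x.
by rewrite -[RHS]enum_rankK; congr enum_val; apply: val_inj.
Qed.

Lemma card_bijection (T U : finType) : #|T| = #|U| ->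
  exists f : T -> U, bijective f.
Proof.
move=> eqTU; exists (fun x => enum_val (cast_ord eqTU (enum_rank x))).
exists (fun x => enum_val (cast_ord (esym eqTU) (enum_rank x))) => x.
  by rewrite enum_valK cast_ordK enum_rankK.
by rewrite enum_valK cast_ordKV enum_rankK.
Qed.

Lemma card_tuple_thead (T : finType) (m : nat) (P : pred T) :
  #|[set t : m.+1.-tuple T | P (thead t)]| = #|[set x | P x]| * #|T| ^ m.
Proof.
rewrite -card_tuple -cardsT -cardsX.
rewrite -(card_imset (f := fun x : T * m.-tuple T => [tuple of x.1 :: x.2])).
  apply: eq_card => t; rewrite inE; apply/idP/imsetP => [Pt|[[x u]]].
    exists (thead t, [tuple of behead t]); first by rewrite !inE Pt.
    by rewrite {1}(tuple_eta t); apply: val_inj.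
  by rewrite !inE /= andbT => Px ->; rewrite theadE.
move=> [x u] [x1 u1] E. by case: E => -> /val_inj ->.
Qed.

Variables (R : realType) (n S r : nat) (St W : finType).
Variables (ini : W -> St) (upd : St -> op n -> St) (out : St -> R).

(** Only the first tape entry is read, so the others cancel from the success probability. States
    need just an injective encoding, but [W] must match the bit strings exactly to stay uniform. *)
Lemma finite_memory_algo : 0 < #|St| <= 2 ^ S -> #|W| = 2 ^ r ->
  exists A : algo R n S, forall (eps : R) (s : seq (op n)),
  succ_prob A eps s =
  (#|[set w | (`|out (foldl upd (ini w) s) - (F1 (gvec s))%:R| <=
      eps * (F1 (gvec s))%:R)%R]|%:R / #|W|%:R)%R.
Proof.
case/andP=> St_gt0 leSt eqW.
have [||enc [dec encK]] := @card_embed St (S.-tuple bool) => //.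
  by rewrite card_tuple card_bool.
have [|phi phi_bij] := @card_bijection (r.-tuple bool) W.
  by rewrite card_tuple card_bool.
pose A := @Algo R n S r (fun x => enc (ini (phi x)))
  (fun st o _ => enc (upd (dec st) o)) (fun st _ => out (dec st)).
exists A => eps s; rewrite /succ_prob.
have runE (rs : (size s).+2.-tuple ((rbits A).-tuple bool)) :
    run rs = out (foldl upd (ini (phi (thead rs))) s).
  rewrite /run /=; congr out.
  rewrite (_ : nth _ rs 0 = thead rs); last by rewrite [in LHS](tuple_eta rs).
  have : forall st k, foldl (fun st p => enc (upd (dec st) p.1)) (enc st)
      (zip s (iota k (size s))) = enc (foldl upd st s).
    by elim: s {rs} => //= o s IH st k; rewrite encK IH.
  by move=> ->; rewrite encK.
have -> : [set rs : (size s).+2.-tuple ((rbits A).-tuple bool) |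
      (`|run rs - (F1 (gvec s))%:R| <= eps * (F1 (gvec s))%:R)%R] =
    [set rs : (size s).+2.-tuple (r.-tuple bool) |
      (`|out (foldl upd (ini (phi (thead rs))) s) - (F1 (gvec s))%:R|
        <= eps * (F1 (gvec s))%:R)%R].
  by apply/setP => rs; rewrite !inE runE.
rewrite (card_tuple_thead _ (fun x =>
  `|out (foldl upd (ini (phi x)) s) - (F1 (gvec s))%:R|
        <= eps * (F1 (gvec s))%:R)%R).
rewrite [in X in (_ / X)%R]card_tuple.
have cardr : #|{: r.-tuple bool}| = #|W| by rewrite eqW card_tuple card_bool.
rewrite cardr [in X in (_ / X)%R]expnS.
have W_neq0 : ((#|W| ^ (size s).+1)%:R != 0 :> R)%R.
  by rewrite pnatr_eq0 expn_eq0 eqW expn_eq0.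
rewrite !natrM -mulf_div divff // mulr1; congr (_%:R / _)%R.
rewrite -(card_imset _ (bij_inj phi_bij)); apply: eq_card => w.
case: phi_bij => phi' phiK phi'K.
rewrite inE; apply/imsetP/idP => [[x + ->]|Pw]; first by rewrite inE.
by exists (phi' w); rewrite ?inE phi'K.
Qed.
End FiniteMemory.

(** * The samplers: invariant, state count and accuracy *)

Section Sampler.
Variables (R : realType) (n M K L : nat).

(* Insertion counter, random words, and the item currently held by each
   sampler ([None] if its insertion is still to come or was forgotten). *)
Definition sampler_state : finType :=
  ('I_M.+1 * {ffun 'I_K -> 'I_(2 ^ L)} * {ffun 'I_K -> option 'I_n})%type.

Definition sampler_init (w : {ffun 'I_K -> 'I_(2 ^ L)}) : sampler_state :=
  (ord0, w, [ffun=> None]).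

(** The current insertion has number [t]. The last [None] is for a residue moved by a doubling.
    [inord] is faithful while the counter stays within [M]. *)
Definition sampler_upd (st : sampler_state) (o : op n) : sampler_state :=
  let: (t, w, x) := st in
  match o with
  | Ins i =>
      (inord t.+1, w,
       [ffun k => if (w k %% window t.+1)%N == t then Some i
                  else if (w k %% window t.+1 == w k %% window t)%N then x k
                  else None])
  | Forget i => (t, w, [ffun k => if x k == Some i then None else x k])
  end.

(** The window length times the fraction of samplers holding an item. *)
Definition sampler_out (st : sampler_state) : R :=
  let: (t, w, x) := st in
  (window t)%:R * (\sum_k (x k : bool))%:R / K%:R.

Lemma sampler_run s w : (n_ins s <= M)%N ->
  foldl sampler_upd (sampler_init w) s =
  (inord (n_ins s), w, [ffun k => live s (w k %% window (n_ins s))]).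
Proof.
elim/last_ind: s => [_|s o IH].
  by rewrite /= /sampler_init;
    congr (_, _, _); apply: val_inj; rewrite /= inordK.
rewrite n_ins_rcons foldl_rcons; case: o => i /=; rewrite ?addn1 ?addn0 => leM.
  rewrite IH 1?ltnW //= inordK ?ltnS 1?ltnW //.
  congr (_, _, _); apply/ffunP => k; rewrite !ffunE live_Ins.
  case: ifP => // ne; case: eqP => [->//|ne'].
  (* The residue has moved beyond all insertions so far, where nothing is live, so [None] is
     correct. *)
  by have [//|lt] := modn_windowS (n_ins s) (w k); rewrite live_late // ltnW.
rewrite IH //=; congr (_, _, _).
by apply/ffunP => k; rewrite !ffunE live_Forget.
Qed.

Lemma card_sampler_state :
  #|sampler_state| = (M.+1 * (2 ^ L * n.+1) ^ K)%N.
Proof.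
by rewrite !card_prod !card_ffun !card_ord card_option card_ord expnMn mulnA.
Qed.

Lemma sampler_accuracy (alpha eps : R) (s : seq (op n)) :
  (0 < K)%N -> (0 < L)%N -> (M < 2 ^ L)%N -> (n_ins s <= M)%N ->
  alpha < 1 -> 0 < eps -> eps <= 1 -> RFDS alpha s ->
  1 - 2 * expR (- (K%:R * (1 - alpha) * eps ^+ 2 / 16)) <=
  #|[set w | `|sampler_out (foldl sampler_upd (sampler_init w) s)
               - (F1 (gvec s))%:R| <= eps * (F1 (gvec s))%:R]|%:R
  / #|{ffun 'I_K -> 'I_(2 ^ L)}|%:R.
Proof.
move=> K0 L0 ltM leM alpha1 eps0 eps1; rewrite /RFDS F1_fvec.
set T := n_ins s; set F := (F1 (gvec s))%:R => rfds.
pose b := window T; have b0 : (0 < b)%N := window_gt0 T.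
pose G (a : 'I_(2 ^ L)) : bool := live s (a %% b)%N.
have W0 : (0 < #|'I_(2 ^ L)|)%N by rewrite card_ord expn_gt0.
have bR : 0 < b%:R :> R by rewrite ltr0n.
have KR : 0 < K%:R :> R by rewrite ltr0n.
(* Exact, not approximate, because [b] divides 2^L. *)
have pE : #|G|%:R / #|'I_(2 ^ L)|%:R = F / b%:R :> R.
  have NR : (2 ^ L)%:R != 0 :> R by rewrite pnatr_eq0 expn_eq0.
  apply/eqP; rewrite card_ord eqr_div //; last by rewrite gt_eqF.
  rewrite -!natrM eqr_nat.
  rewrite -(F1_gvec_live (ltnW (window_gt T))) [eqbRHS]mulnC.
  rewrite -(sum_modn (fun p => live s p : bool) b0); last first.
    by rewrite window_dvd // (leq_ltn_trans leM).
  by rewrite -sum1_card big_mkcond; apply/eqP; congr (_ * _)%N.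
have outE w : sampler_out (foldl sampler_upd (sampler_init w) s) =
    b%:R * (hits G w)%:R / K%:R.
  rewrite sampler_run // /sampler_out inordK ?ltnS //.
  rewrite /hits; congr (_ * _%:R / _).
  by apply: eq_bigr => k _; rewrite ffunE.
set good := [set w | _].
pose bad := [set u : {ffun 'I_K -> 'I_(2 ^ L)} |
  eps * (K%:R * (F / b%:R)) < `|(hits G u)%:R - K%:R * (F / b%:R)|].
have goodE : good = ~: bad.
  apply/setP => w; rewrite !inE outE -leNgt.
  have -> : b%:R * (hits G w)%:R / K%:R - F =
      (b%:R / K%:R) * ((hits G w)%:R - K%:R * (F / b%:R)).
    by field; rewrite !gt_eqF.
  rewrite normrM gtr0_norm ?divr_gt0 // -ler_pdivlMl ?divr_gt0 //.
  by congr (_ <= _); field; rewrite !gt_eqF.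
have WR : 0 < #|{ffun 'I_K -> 'I_(2 ^ L)}|%:R :> R.
  by rewrite ltr0n card_ffun expn_gt0 W0.
have cardE : #|{ffun 'I_K -> 'I_(2 ^ L)}|%:R = #|bad|%:R + #|good|%:R :> R.
  by rewrite goodE -natrD cardsC.
rewrite ler_pdivlMr // mulrBl mul1r lerBlDr {1}cardE [leRHS]addrC lerD2r.
rewrite [leRHS]mulrC; move: rfds; case: (posnP T) => [T0 _|T0 rfds].
  have -> : bad = set0.
    apply/setP => u; rewrite !inE.
    have -> : hits G u = 0%N.
      by rewrite /hits big1 // => k _; rewrite /G live_late // -/T T0.
    have -> : F = 0.
      by rewrite /F -(F1_gvec_live (b := 0)) ?big_ord0 // -/T T0.
    by rewrite !mul0r !mulr0 subr0 normr0 ltxx.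
  by rewrite cards0 !mulr_ge0 ?expR_ge0.
have := @chernoff R _ G K W0 eps eps0 eps1; rewrite pE -/bad => /le_trans; apply.
rewrite ler_wpM2l // ler_wpM2l // ler_expR lerN2.
(* The promise gives F >= (1 - alpha) T and the window has b <= 2 T; this loss of 2 turns the 8 of
   [chernoff] into 16. *)
have lep : (1 - alpha) / 2 <= F / b%:R.
  rewrite ler_pdivlMr // (le_trans _ rfds) //.
  have : (b%:R : R) <= 2 * T%:R by rewrite -natrM ler_nat window_le.
  by rewrite mulrAC ler_pdivrMr // -mulrA => h; rewrite ler_wpM2l ?[_ * 2]mulrC //; lra.
have -> : K%:R * (1 - alpha) * eps ^+ 2 / 16 =
  (K%:R * eps ^+ 2 / 8) * ((1 - alpha) / 2) by field.
have -> : K%:R * (F / b%:R) * eps ^+ 2 / 8 =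
  (K%:R * eps ^+ 2 / 8) * (F / b%:R).
  by field; rewrite gt_eqF.
by rewrite ler_wpM2l // divr_ge0 // mulr_ge0 ?sqr_ge0 // ltW.
Qed.

End Sampler.

(** * Logarithm estimates and the number of samplers *)

Section Size.
Variable R : realType.

Lemma ln2_ge_half : 1 / 2 <= ln (2 : R).
Proof.
rewrite -ler_expR lnK ?posrE //.
(* At 1 / 2 the quadratic bound equals 2. *)
have := expR_le_quadratic (lexx (1 / 2 : R)).
by move=> /le_trans; apply; lra.
Qed.

Lemma ln2_le1 : ln (2 : R) <= 1.
Proof. by rewrite -ler_expR lnK ?posrE // (le_trans _ (expR_ge1Dx _)). Qed.

Lemma trunc_log2_le_ln (n : nat) : (0 < n)%N ->
  (trunc_log 2 n)%:R <= 2 * ln (n%:R : R).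
Proof.
move=> n_gt0.
have : ln ((2 ^ trunc_log 2 n)%:R : R) <= ln n%:R.
  by rewrite ler_ln ?posrE ?ltr0n ?expn_gt0 // ler_nat trunc_logP.
rewrite natrX lnXn // -[_ *+ trunc_log 2 n]mulr_natl.
have := ln2_ge_half; have : 0 <= (trunc_log 2 n)%:R :> R by [].
move: (ln 2) (ln n%:R) (trunc_log 2 n)%:R => x y z; nra.
Qed.

Lemma sampler_number (alpha eps delta : R) :
  0 < eps -> eps < 1 / 2 -> 0 < alpha -> alpha < 1 -> 0 < delta -> delta < 1 ->
  exists K : nat, [/\ (0 < K)%N,
    2 * expR (- (K%:R * (1 - alpha) * eps ^+ 2 / 16)) <= delta &
    K%:R <= 33 * ((1 - alpha)^-1 * eps ^- 2 * Num.max 1 (ln delta^-1))].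
Proof.
move=> eps0 eps1 alpha0 alpha1 delta0 delta1.
pose q := (1 - alpha)^-1 * eps ^- 2.
have a0 : 0 < 1 - alpha by lra.
have e0 : 0 < eps ^+ 2 by rewrite exprn_gt0.
have q1 : 1 <= q.
  by rewrite /q -invfM invf_ge1 ?mulr_gt0 // expr2; nra.
have q0 : 0 < q by lra.
set l := ln delta^-1; have m1 : 1 <= Num.max 1 l by rewrite le_max lexx.
have ml : l <= Num.max 1 l by rewrite le_max lexx orbT.
move: (Num.max 1 l) m1 ml => m m1 ml.
have x0 : 0 <= 32 * (q * m) by nra.
(* ln (2 / delta) <= 2 * m turns the 16 * q * ln (2 / delta) samplers asked for
   by the Chernoff bound into 32 * q * m. *)
exists (Num.truncn (32 * (q * m))).+1; split=> //.
  set K := (Num.truncn _).+1.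
  have leK : 32 * (q * m) <= K%:R by apply/ltW/truncnS_gt.
  rewrite -(lnK (_ : 2 \in Num.pos)) ?posrE // -expRD.
  rewrite -[leRHS](lnK (_ : delta \in Num.pos)) ?posrE // ler_expR.
  have le2 := ln2_le1.
  have lE : l = - ln delta by rewrite /l lnV ?posrE.
  suff : 2 * m <= K%:R * (1 - alpha) * eps ^+ 2 / 16 by lra.
  have qE : q * ((1 - alpha) * eps ^+ 2) = 1.
    by rewrite /q; field; rewrite !gt_eqF.
  have := ler_wpM2r (ltW (mulr_gt0 a0 e0)) leK.
  have -> : 32 * (q * m) * ((1 - alpha) * eps ^+ 2) =
      32 * m * (q * ((1 - alpha) * eps ^+ 2)) by ring.
  by rewrite qE mulr1 mulrA; lra.
(* Rounding up adds at most 1 <= q * m, hence 33 instead of 32. *)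
have le_trunc : (Num.truncn (32 * (q * m)))%:R <= 32 * (q * m).
  by rewrite truncn_le.
have qm1 : 1 <= q * m by rewrite mulr_ege1.
by rewrite -[(Num.truncn _).+1%:R]natr1 -/q; lra.
Qed.
End Size.

Theorem mainTheorem7 :
  forall (R : realType) (c : nat),
  exists C : R, 0 < C /\
  forall (n : nat) (eps alpha delta : R),
    (2 <= n)%N ->
    0 < eps -> eps < 1 / 2 ->
    0 < alpha -> alpha < 1 ->
    0 < delta -> delta < 1 ->
    exists (S : nat) (A : algo R n S),
      (S%:R <= C * (1 - alpha)^-1 * eps^-2
                 * Num.max 1 (ln (n%:R : R)) * Num.max 1 (ln delta^-1))
      /\ forall s : seq (op n),
           (size s <= n ^ c)%N ->
           RFDS alpha s ->
           1 - delta <= succ_prob A eps s.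
Proof.
(* 198 = 2 * 33 * 3, from [leSKl], [sampler_number] and [le_l]. *)
move=> R c; exists (198 * c.+2%:R); split; first by rewrite mulr_gt0.
move=> n eps alpha delta n2 eps0 eps1 alpha0 alpha1 delta0 delta1.
have [K [K0 leK Kle]] := sampler_number eps0 eps1 alpha0 alpha1 delta0 delta1.
(* [l] bits encode an element of [option 'I_n], and [L] bits a counter up to [M]; the successor in
   [L] makes M < 2^L strict even for c = 0. *)
pose l := (trunc_log 2 n).+1; pose L := (c * l).+1; pose M := (n ^ c)%N.
have ltn : (n < 2 ^ l)%N by exact: trunc_log_ltn.
have ltM : (M < 2 ^ L)%N.
  rewrite (@leq_ltn_trans (2 ^ (c * l))) ?ltn_exp2l // mulnC expnM /M.
  by case: (posnP c) => [->//|c0]; rewrite leq_exp2r // ltnW.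
(* One counter, then a word and an optional item for each sampler. *)
pose S := (L + K * (L + l))%N; pose W := {ffun 'I_K -> 'I_(2 ^ L)}.
have leS : (0 < #|sampler_state n M K L| <= 2 ^ S)%N.
  rewrite card_sampler_state !muln_gt0 expn_gt0 muln_gt0 expn_gt0 /=.
  by rewrite expnD leq_mul // [(K * _)%N]mulnC expnM leq_exp2r // expnD leq_mul.
have eqW : #|W| = (2 ^ (L * K))%N by rewrite card_ffun !card_ord expnM.
have [A AE] := finite_memory_algo (@sampler_init n M K L)
  (@sampler_upd n M K L) (@sampler_out R n M K L) leS eqW.
exists S, A; split; last first.
  move=> s les rfds; rewrite AE.
  apply: le_trans (sampler_accuracy K0 _ ltM _ alpha1 eps0 _ rfds) => //.
  - by rewrite lerD2l lerN2.
  - exact: leq_trans (count_size _ _) les.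
  - lra.
have le_l : l%:R <= 3 * Num.max 1 (ln (n%:R : R)).
  rewrite /l -[(trunc_log 2 n).+1%:R]natr1; have := trunc_log2_le_ln R (ltnW n2).
  have : 1 <= Num.max 1 (ln (n%:R : R)) by rewrite le_max lexx.
  have : ln n%:R <= Num.max 1 (ln (n%:R : R)) by rewrite le_max lexx orbT.
  lra.
(* As [l] and [K] are positive, L + l <= (c + 2) l and K + 1 <= 2 K. *)
have leSKl : (S <= 2 * K * c.+2 * l)%N.
  rewrite /S /L /l; move: (trunc_log 2 n) => t; nia.
have leSR : S%:R <= 2 * c.+2%:R * (K%:R * l%:R) :> R.
  by rewrite -!natrM ler_nat (leq_trans leSKl) // mulnA [(2 * K * _)%N]mulnAC.
apply: (le_trans leSR).
have KlR := ler_pM (ler0n R K) (ler0n R l) Kle le_l.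
have c0 : 0 <= 2 * c.+2%:R :> R by rewrite mulr_ge0.
apply: le_trans (ler_wpM2l c0 KlR) _.
by rewrite le_eqVlt; apply/orP; left; apply/eqP; ring.
Qed.
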